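(* Let $n\ge5$. The $\widetilde{\mathscr{D}}$-classes of $\mathcal{E}_n=\mathrm{End}(\mathcal{T}_n)$ are $\mathcal{E}_n\setminus E_1$ and $E_1$, and further, $\widetilde{\mathscr{J}}=\widetilde{\mathscr{D}}$.
   Context: Maps are written on the right and composed left to right. $\mathcal{T}_n$ is the full transformation semigroup of all maps $\{1,\dots,n\}\to\{1,\dots,n\}$; $\mathcal{S}_n$, $\mathcal{A}_n$ are the symmetric and alternating groups. $\mathcal{E}_n=\mathrm{End}(\mathcal{T}_n)$ is the monoid of all semigroup endomorphisms of $\mathcal{T}_n$ (not required to fix the identity map), and $\mathcal{G}_n=\mathrm{Aut}(\mathcal{T}_n)$. For $t,e\in\mathcal{T}_n$, $\phi_{t,e}$ sends $s\mapsto t$ if $s\in\mathcal{S}_n\setminus\mathcal{A}_n$, $s\mapsto t^2$ if $s\in\mathcal{A}_n$, $s\mapsto e$ if $s\in\mathcal{T}_n\setminus\mathcal{S}_n$. By a known theorem of Schein and Teclezghi, $\mathcal{G}_n=\{\psi_g:g\in\mathcal{S}_n\}$ with $\psi_g:s\mapsto g^{-1}sg$ and, for $n\neq4$, $\mathcal{E}_n=\mathcal{G}_n\cup\{\phi_{t,e}: t^3=t,\ te=et=e^2=e\}$. $E_1=\{\phi_{e,e}\in\mathcal{E}_n\}$, the set of endomorphisms whose image has exactly one element. Relations on $\mathcal{E}_n$: $\alpha\mathrel{\widetilde{\mathscr{R}}}\beta$ iff for all idempotents $\eta\in\mathcal{E}_n$, $\eta\alpha=\alpha\Leftrightarrow\eta\beta=\beta$;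 $\alpha\mathrel{\widetilde{\mathscr{L}}}\beta$ iff for all idempotents $\eta\in\mathcal{E}_n$, $\alpha\eta=\alpha\Leftrightarrow\beta\eta=\beta$; $\widetilde{\mathscr{D}}=\widetilde{\mathscr{L}}\vee\widetilde{\mathscr{R}}$ (the smallest equivalence relation containing both); $\alpha\mathrel{\widetilde{\mathscr{J}}}\beta$ iff $\widetilde{J}(\alpha)=\widetilde{J}(\beta)$, where $\widetilde{J}(\alpha)$ is the smallest ideal of $\mathcal{E}_n$ containing $\alpha$ that is saturated by (i.e. is a union of classes of) both $\widetilde{\mathscr{L}}$ and $\widetilde{\mathscr{R}}$. *)

(* Defs.v *)
From HB Require Import structures.
From Corelib Require Import RelationClasses.
From mathcomp Require Import all_boot fingroup perm.

Set Implicit Arguments.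
Unset Strict Implicit.
Unset Printing Implicit Defensive.

Local Open Scope group_scope.

(* A wrapper around [{ffun A -> A}], whose own library product is pointwise
   whenever [A] is itself a magma, as is the case for [A = Tn n] below. *)
Record ftrans (A : finType) : Type :=
  FTrans { ftrans_val :> {ffun A -> A} }.

Section FullTransformations.
Variable A : finType.

HB.instance Definition _ := [isNew for @ftrans_val A].
HB.instance Definition _ := [Finite of ftrans A by <:].

Lemma ftransP (s t : ftrans A) : s =1 t <-> s = t.
Proof. by split=> [/ffunP /val_inj | ->]. Qed.

Definition ftrans_one : ftrans A := FTrans [ffun x => x].
(* Maps act on the right: [s * t] is [s] followed by [t]. *)
Definition ftrans_mul (s t : ftrans A) : ftrans A := FTrans [ffun x => t (s x)].

Fact ftrans_mulA : associative ftrans_mul.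
Proof. by move=> s t u; apply/ftransP=> x; rewrite !ffunE. Qed.
Fact ftrans_mul1 : left_id ftrans_one ftrans_mul.
Proof. by move=> s; apply/ftransP=> x; rewrite !ffunE. Qed.
Fact ftrans_mulr1 : right_id ftrans_one ftrans_mul.
Proof. by move=> s; apply/ftransP=> x; rewrite !ffunE. Qed.

HB.instance Definition _ :=
  isMonoid.Build (ftrans A) ftrans_mulA ftrans_mul1 ftrans_mulr1.

Lemma ftrans1E (x : A) : (1 : ftrans A) x = x.
Proof. exact: ffunE. Qed.

Lemma ftransME (s t : ftrans A) (x : A) : (s * t) x = t (s x).
Proof. exact: ffunE. Qed.

End FullTransformations.

Definition Tn (n : nat) := ftrans 'I_n.

(* Semigroup endomorphisms: the identity need not be fixed. *)
Definition is_endo (n : nat) : pred (ftrans (Tn n)) :=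
  fun f => [forall s : Tn n, forall t : Tn n, f (s * t) == f s * f t].

Record En (n : nat) : Type :=
  Endo { endo_val :> ftrans (Tn n); endo_valP : is_endo endo_val }.

Section EndomorphismMonoid.
Variable n : nat.

HB.instance Definition _ := [isSub for @endo_val n].
HB.instance Definition _ := [Finite of En n by <:].

Fact endo_one_subproof : is_endo (1 : ftrans (Tn n)).
Proof. by apply/forallP=> s; apply/forallP=> t; rewrite !ftrans1E. Qed.
Fact endo_mul_subproof (f g : En n) : is_endo (val f * val g).
Proof.
case: f g => [f fP] [g gP]; apply/forallP=> s; apply/forallP=> t.
have fM : f (s * t) = f s * f t by apply/eqP; move/forallP/(_ s)/forallP: fP.
have gM x y : g (x * y) = g x * g y.
  by apply/eqP; move/forallP/(_ x)/forallP: gP.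
by rewrite !ftransME fM gM.
Qed.

Definition endo_one : En n := Endo endo_one_subproof.
Definition endo_mul (f g : En n) : En n := Endo (endo_mul_subproof f g).

Fact endo_mulA : associative endo_mul.
Proof. by move=> f g h; apply: val_inj; rewrite /= mulgA. Qed.
Fact endo_mul1 : left_id endo_one endo_mul.
Proof. by move=> f; apply: val_inj; rewrite /= mul1g. Qed.
Fact endo_mulr1 : right_id endo_one endo_mul.
Proof. by move=> f; apply: val_inj; rewrite /= mulg1. Qed.

HB.instance Definition _ :=
  isMonoid.Build (En n) endo_mulA endo_mul1 endo_mulr1.

(* [insub s] is [Some p] exactly when [s] is the underlying map of the
   permutation [p]; [odd_perm p] is the coercion of [p] to [bool]. *)
Definition phi (t e : Tn n) : ftrans (Tn n) :=
  FTrans [ffun s : Tn n =>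
    if (insub (ftrans_val s) : option 'S_n) is Some p
    then (if odd_perm p then t else t * t) else e].

Definition E1 : {set En n} :=
  [set a : En n | [exists e : Tn n, val a == phi e e]].

End EndomorphismMonoid.

Section TildeRelations.
Variable M : monoidType.
Implicit Types (a b c x h : M) (I : M -> Prop).

Definition idem h : Prop := h * h = h.

Definition tildeR a b : Prop :=
  forall h, idem h -> (h * a = a <-> h * b = b).

Definition tildeL a b : Prop :=
  forall h, idem h -> (a * h = a <-> b * h = b).

Definition tildeD a b : Prop :=
  forall Q : M -> M -> Prop, Equivalence Q ->
    (forall x y, tildeL x y -> Q x y) -> (forall x y, tildeR x y -> Q x y) ->
    Q a b.

Definition ideal I : Prop :=
  (exists a, I a) /\ (forall a x, I a -> I (x * a) /\ I (a * x)).

Definition saturated (Q : M -> M -> Prop) I : Prop :=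
  forall a b, Q a b -> I a -> I b.

(* The intersection of the ideals in question; it is itself one of them. *)
Definition tildeJ_ideal a : M -> Prop := fun c =>
  forall I, ideal I -> saturated tildeL I -> saturated tildeR I -> I a -> I c.

Definition tildeJ a b : Prop :=
  forall c, tildeJ_ideal a c <-> tildeJ_ideal b c.

End TildeRelations.

Definition is_class_of (T : finType) (Q : T -> T -> Prop) (C : {set T}) : Prop :=
  exists a, forall b, b \in C <-> Q a b.

(* Main.v *)
Require Import Defs.
From mathcomp Require Import all_boot fingroup perm alt gseries.

(** Let [parity s] be odd or even when [s] is a permutation, and [None] when
    [s] is singular.  The whole argument rests on one dichotomy
    ([noninjective_parity]): for [n >= 5] an endomorphism of [T_n] that is not
    injective takes a single value on each of the three parity classes.

    To see it, suppose first that [a] is injective on [S_n].  Two elements with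
    the same image differ at a point, so multiplying constant maps by them
    identifies two constants, and then all of them by 2-transitivity.  The
    common image of the constants is fixed by [a S_n] on the right, so [S_n]
    would act faithfully on [n] points with a fixed point, which is impossible.
    Hence [a] is not injective on [S_n], and since [A_n] is simple it is
    constant on each coset of [A_n].  It is then insensitive to even factors, so
    it identifies all constants, as well as all the idempotents moving one point
    [i] to a fixed [j].  Those multiply to the constant [j], so they share the
    image [z] of the constants.  Finally any singular [s] equals [f * s] for
    such an idempotent [f], whence [a s = z].

    Consequently a nonconstant endomorphism has one of three kernels: equality,
    permutation against singular, or equality of parities ([rank2_ker],
    [rank3_ker]).  Endomorphisms with the same kernel are related by [tildeR].
    On the other hand an idempotent other than 1 collapses all singular maps, so
    an endomorphism whose image contains two singular maps is related to 1 by
    [tildeL] ([tildeL_one_of_singular_image]).  Each of the last two kernels is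
    realised by such an endomorphism ([phi_witness]), so every nonconstant
    endomorphism is related to 1 by [tildeD].

    Constant endomorphisms are right zeros of the monoid.  This makes them
    pairwise [tildeR]-related, and shows that [E1] is an ideal saturated by
    [tildeL] and [tildeR].  So [E1] and its complement are the two classes of
    [tildeD], and [tildeJ] separates them too; conversely [tildeD] is contained
    in [tildeJ] in every monoid. *)

Set Implicit Arguments.
Unset Strict Implicit.
Unset Printing Implicit Defensive.

Local Open Scope group_scope.

(** * Homomorphisms defined on a symmetric group *)

Lemma perm_noncentral (T : finType) (k : {perm T}) :
  2 < #|T| -> k != 1 -> exists g, k * g != g * k.
Proof.
move=> cardT k1; have [x kx]: exists x, k x != x.
  apply/existsP; apply: contraR k1 => /existsPn kid.
  by apply/eqP/permP=> x; rewrite perm1; apply/eqP; rewrite -[_ == _]negbK.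
have [z]: exists z, z \notin [:: x; k x].
  apply/existsP; apply: contraLR cardT => /existsPn xz; rewrite -leqNgt.
  have: size (enum T) <= size [:: x; k x].
    by apply: uniq_leq_size (enum_uniq _) _ => z _; move: (xz z); rewrite negbK.
  by rewrite -cardE.
rewrite !inE negb_or => /andP[zx zk]; exists (tperm (k x) z).
apply: contra_neq zk => /permP/(_ x).
by rewrite !permM tpermL tpermD // eq_sym.
Qed.

(** The elements of the alternating group identified with 1 form a normal
    subgroup of it, so by simplicity it is enough to find a nontrivial one: a
    commutator of a nontrivial permutation identified with 1. *)
Lemma perm_morph_parity (T : finType) (M : monoidType) (f : {perm T} -> M) :
    4 < #|T| -> {morph f : p q / p * q} -> ~ injective f ->
  forall p q, odd_perm p = odd_perm q -> f p = f q.
Proof.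
move=> cardT fM fninj.
have fV p : f p * f p^-1 = f 1 by rewrite -fM mulgV.
have f1 p : f p * f 1 = f p by rewrite -fM mulg1.
have f1l p : f 1 * f p = f p by rewrite -fM mul1g.
have [k k1 fk]: exists2 k, k != 1 & f k = f 1.
  have /injectivePn[p [q pq fpq]]: ~~ injectiveb f by apply/injectiveP.
  exists (p * q^-1); last by rewrite fM fpq fV.
  by rewrite -eq_mulgV1.
pose K := [set p in 'Alt_T | f p == f 1].
have inK p : (p \in K) = ~~ odd_perm p && (f p == f 1).
  by rewrite in_set Alt_even.
have groupK : group_set K.
  apply/group_setP; split=> [|p q]; rewrite !inK ?odd_perm1 ?eqxx //.
  case/andP=> pA /eqP fp /andP[qA /eqP fq].
  by rewrite odd_permM (negPf pA) qA fM fp fq f1 eqxx.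
have nKA : Group groupK <| 'Alt_T.
  apply/normalP; split=> [|g gA]; first by apply/subsetP=> p /setIdP[].
  apply/eqP; rewrite eqEcard cardJg leqnn andbT.
  apply/subsetP=> _ /imsetP[p + ->].
  rewrite !inK odd_permJ => /andP[-> /eqP fp] /=.
  by rewrite conjgE !fM fp -!fM mul1g mulVg.
have fKE p : f p = f 1 -> f p^-1 = f 1 by move=> fp; rewrite -(fV p) fp f1l.
have [g kg] := perm_noncentral (ltn_trans (isT : 2 < 4) cardT) k1.
(* The commutator of k with a non-commuting permutation is even, nontrivial and
   identified with 1 by f. *)
have cK : [~ k, g] \in K.
  rewrite inK /commg odd_permM odd_permV odd_permJ addbb /=.
  by rewrite conjgE !fM (fKE k) // fk -!fM !mul1g mulVg.
have c1 : [~ k, g] != 1 by apply: contra kg => /commgP/eqP; rewrite eq_sym.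
have KA : 'Alt_T = Group groupK :> {set _}.
  have [_ simA] := simpleP _ (simple_Alt5 cardT).
  have [K1|KA] := simA _ nKA; last by rewrite -KA.
  move: cK c1; rewrite -[K]/(gval (Group groupK)) K1 => /set1P->.
  by rewrite eqxx.
move=> p q pq; have: p * q^-1 \in 'Alt_T.
  by rewrite Alt_even odd_permM odd_permV pq addbb.
rewrite KA /= inK => /andP[_ /eqP fpq].
by rewrite -(f1l q) -fpq -fM mulgKV.
Qed.

Lemma exists_notin n (s : seq 'I_n) : size s < n -> exists x, x \notin s.
Proof.
move=> sn; apply/existsP; apply: contraLR sn => /existsPn xs; rewrite -leqNgt.
rewrite -[n in n <= _]card_ord cardE.
apply: uniq_leq_size (enum_uniq _) _ => x _.
by move: (xs x); rewrite negbK.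
Qed.

(** * Transformations and the parity of a transformation *)

Section Transformations.
Variable n : nat.
Implicit Types (s t e : Tn n) (p q : 'S_n) (x y i j : 'I_n).

Definition perm_map p : Tn n := FTrans [ffun x => p x].
Definition const_map x : Tn n := FTrans [ffun=> x].
Definition collapse (A : seq 'I_n) j : Tn n :=
  FTrans [ffun x => if x \in A then j else x].

Lemma perm_mapE p x : perm_map p x = p x. Proof. exact: ffunE. Qed.
Lemma const_mapE x y : const_map x y = x. Proof. exact: ffunE. Qed.
Lemma collapseE A j x : collapse A j x = if x \in A then j else x.
Proof. exact: ffunE. Qed.

Definition transE := (ftransME, ftrans1E, perm_mapE, const_mapE, collapseE).

Lemma perm_mapM : {morph perm_map : p q / p * q}.
Proof. by move=> p q; apply/ftransP=> x; rewrite !transE permM. Qed.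

Lemma perm_map1 : perm_map 1 = 1.
Proof. by apply/ftransP=> x; rewrite !transE perm1. Qed.

Lemma const_mapM x s : const_map x * s = const_map (s x).
Proof. by apply/ftransP=> y; rewrite !transE. Qed.

Lemma const_mapMr x s : s * const_map x = const_map x.
Proof. by apply/ftransP=> y; rewrite !transE. Qed.

Definition parity s : option bool :=
  omap (@odd_perm _) (insub (ftrans_val s) : option 'S_n).

Lemma phiE t e s :
  phi t e s = if parity s is Some b then (if b then t else t * t) else e.
Proof. by rewrite /phi ffunE /parity; case: insub. Qed.

Lemma parity_perm p : parity (perm_map p) = Some (odd_perm p).
Proof.
rewrite /parity; suff -> : ftrans_val (perm_map p) = val p by rewrite valK.
by apply/ffunP=> x; rewrite !transE -pvalE.
Qed.

Variant parity_spec s : option bool -> Prop :=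
| ParityPerm p of s = perm_map p : parity_spec s (Some (odd_perm p))
| ParityNone i j of i != j & s i = s j : parity_spec s None.

Lemma parityP s : parity_spec s (parity s).
Proof.
rewrite /parity; case: insubP => [p _ sp | /injectivePn[i [j ij sij]]] /=.
  by apply: ParityPerm; apply/ftransP=> x; rewrite transE -sp -pvalE.
exact: ParityNone ij sij.
Qed.

Lemma parity_None i j s : i != j -> s i = s j -> parity s = None.
Proof.
move=> ij sij; case: parityP => // p sp; case/eqP: ij.
by apply: (@perm_inj _ p); rewrite -!perm_mapE -sp.
Qed.

Lemma parityM s t :
  parity (s * t) = if (parity s, parity t) is (Some a, Some b)
                   then Some (a (+) b) else None.
Proof.
case: (parityP s) => [p ->|i j ij sij]; last first.
  by apply: (@parity_None i j) => //; rewrite !ftransME sij.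
case: (parityP t) => [q ->|i j ij tij].
  by rewrite -perm_mapM parity_perm odd_permM.
apply: (@parity_None (p^-1 i) (p^-1 j)); last by rewrite !transE !permKV.
by rewrite (inj_eq perm_inj).
Qed.

(** Multiplying by [e] absorbs everything and [t * t] is the identity of the
    subgroup [{t, t * t}], so [phi t e] respects products of parities. *)
Lemma phi_endo t e :
  t * t * t = t -> t * e = e -> e * t = e -> e * e = e -> is_endo (phi t e).
Proof.
move=> t3 te et ee; apply/forallP=> s; apply/forallP=> u; apply/eqP.
rewrite !phiE parityM.
by case: (parity s) => [[]|]; case: (parity u) => [[]|];
  rewrite ?mulgA ?t3 ?et ?et ?ee // -?mulgA ?te ?te.
Qed.

Lemma endoM (a : En n) s t : a (s * t) = a s * a t.
Proof. by have /forallP/(_ s)/forallP/(_ t)/eqP := endo_valP a. Qed.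

Lemma En_mulE (a b : En n) s : (a * b) s = b (a s).
Proof. exact: ftransME. Qed.

Lemma En_ext (a b : En n) : a =1 b -> a = b.
Proof. by move=> ab; apply/val_inj/ftransP. Qed.

End Transformations.

(** The action is by transformations, with [f 1] only an idempotent: every
    [f p] permutes the image of [f 1], and acts faithfully on it.  Extending by
    the identity gives an injection of the symmetric group into itself, hence a
    bijection, although no permutation in its image moves [y]. *)
Lemma faithful_perm_action_no_fixpoint
    (T : finType) (f : {perm T} -> Defs.ftrans T) (y : T) :
    1 < #|T| -> {morph f : p q / p * q} -> injective f ->
  ~ (forall p, f p y = y).
Proof.
move=> cardT fM finj fy.
have e_f p x : f 1 (f p x) = f p x by rewrite -ftransME -fM mulg1.
have f_e p x : f p (f 1 x) = f p x by rewrite -ftransME -fM mul1g.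
have ffV p x : f p^-1 (f p x) = f 1 x by rewrite -ftransME -fM mulgV.
pose q p x := if f 1 x == x then f p x else x.
have qinj p : injective (q p).
  move=> x x'; rewrite /q; case: eqP => [ex|nex]; case: eqP => [ex'|nex'] // E.
  - by rewrite -ex -ex' -(ffV p x) E ffV.
  - by case: nex'; rewrite -E e_f.
  - by case: nex; rewrite E e_f.
have Qinj : injective (fun p => perm (qinj p)).
  move=> p p' /permP Q; apply: finj; apply/ftransP=> x.
  by move: (Q (f 1 x)); rewrite !permE /q e_f eqxx !f_e.
have [y' yy'] : exists y', y' != y.
  by move: cardT => /card_gt1P[u [v [_ _ uv]]]; case: (eqVneq u y) uv => [-> |];
    [exists v; rewrite eq_sym | exists u].
have /codomP[p /permP/(_ y)] := injF_onto Qinj (tperm y y').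
by rewrite tpermL permE /q !fy eqxx => y'y; rewrite y'y eqxx in yy'.
Qed.

(** * Endomorphisms that are not injective *)

Section NoninjectiveEndomorphisms.
Variable n : nat.
Hypothesis n5 : 4 < n.
Implicit Types (a b : En n) (s t : Tn n) (p q : 'S_n) (x y i j : 'I_n).

Let perm_morph a : {morph (fun p => a (perm_map p)) : p q / p * q}.
Proof. by move=> p q; rewrite perm_mapM endoM. Qed.

(** The common image of the constants would otherwise give a fixed point of
    the faithful action of the symmetric group through [a]. *)
Lemma noninjective_on_perm a :
  ~ injective a -> ~ injective (fun p => a (perm_map p)).
Proof.
move=> aninj pinj; apply: aninj => s t ast; apply/ftransP=> w.
apply/eqP; apply: contraT => suv; exfalso.
(* The two points where s and t send w give two constants with the same image,
   and fixing one while moving the other reaches every constant. *)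
have cuv : a (const_map (s w)) = a (const_map (t w)).
  by rewrite -!const_mapM !endoM ast.
have cE y : a (const_map y) = a (const_map (s w)).
  have [->//|yu] := eqVneq y (s w).
  transitivity (a (const_map (t w) * perm_map (tperm (t w) y))).
    by rewrite const_mapM perm_mapE tpermL.
  by rewrite endoM -cuv -endoM const_mapM perm_mapE tpermD // eq_sym.
apply: (@faithful_perm_action_no_fixpoint _ (fun p => a (perm_map p))
          (a (const_map (s w)) w) _ (perm_morph a) pinj) => [|p].
  by rewrite card_ord (ltn_trans _ n5).
by rewrite -ftransME -endoM const_mapM cE.
Qed.

Lemma noninjective_parity_perm a p q :
  ~ injective a -> odd_perm p = odd_perm q -> a (perm_map p) = a (perm_map q).
Proof.
move=> /noninjective_on_perm aninj.
by apply: (perm_morph_parity _ (perm_morph a)); rewrite ?card_ord.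
Qed.

(** An auxiliary point [l] turns the transposition of [i] and [k] into a
    3-cycle, to correct its parity. *)
Lemma even_perm_moving i k j :
  k != j -> i != j -> exists p, [/\ ~~ odd_perm p, p i = k & p j = j].
Proof.
move=> kj ij; have [<-|ik] := eqVneq i k.
  by exists 1; rewrite odd_perm1 !perm1.
have [l] : exists l, l \notin [:: i; k; j] by apply: exists_notin; apply: ltnW.
rewrite !inE !negb_or => /and3P[li lk lj].
exists (tperm i k * tperm i l); split.
- by rewrite odd_permM !odd_tperm ik eq_sym li.
- by rewrite permM tpermL tpermD // eq_sym.
- by rewrite permM !tpermD // eq_sym.
Qed.

(** Even permutations have the same image as 1. *)
Lemma noninjective_even a p s :
  ~ injective a -> ~~ odd_perm p -> a (perm_map p * s) = a s /\
  a (s * perm_map p) = a s.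
Proof.
move=> aninj pev; have E : a (perm_map p) = a 1.
  rewrite -perm_map1; apply: noninjective_parity_perm => //.
  by rewrite odd_perm1 (negPf pev).
by rewrite !endoM E -!endoM mul1g mulg1.
Qed.

Lemma noninjective_const a x y :
  ~ injective a -> a (const_map x) = a (const_map y).
Proof.
move=> aninj; have [l] : exists l, l \notin [:: x; y].
  by apply: exists_notin; apply: ltn_trans n5.
rewrite !inE !negb_or => /andP[lx ly].
have [||p [pev px _]] := @even_perm_moving x y l; rewrite 1?eq_sym //.
rewrite -(proj2 (noninjective_even (const_map x) aninj pev)).
by rewrite const_mapM perm_mapE px.
Qed.

(** For fixed [j] the idempotents [collapse [:: i] j] are conjugate under even
    permutations, so they have the same image [u], and [u * u = u].  The
    constant [j] is the product of all of them, so its image is [u] as well. *)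
Lemma noninjective_collapse a i j :
  ~ injective a -> i != j -> a (collapse [:: i] j) = a (const_map j).
Proof.
move=> aninj ij.
have conj k : k != j -> a (collapse [:: k] j) = a (collapse [:: i] j).
  move=> kj; have [p [pev pi pj]] := even_perm_moving kj ij.
  rewrite -(proj1 (noninjective_even (collapse [:: k] j) aninj pev)).
  rewrite -(proj2 (noninjective_even (collapse [:: i] j) aninj pev)).
  congr (a _); apply/ftransP=> x.
  by rewrite !transE !inE -pi (inj_eq perm_inj); case: ifP => // _; rewrite pj.
have many A : A != [::] -> j \notin A ->
    a (collapse A j) = a (collapse [:: i] j).
  elim: A => // k A IH _; rewrite inE negb_or => /andP[jk jA].
  have [->|A0] := eqVneq A [::]; first by rewrite conj // eq_sym.
  have -> : collapse (k :: A) j = collapse [:: k] j * collapse A j.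
    apply/ftransP=> x; rewrite !transE !inE; case: (x == k) => //=.
    by rewrite if_same.
  rewrite endoM IH // conj 1?eq_sym // -endoM; congr (a _).
  apply/ftransP=> x; rewrite !transE.
  case: (x \in _) / boolP => [_|/negPf->] //.
  by rewrite if_same.
rewrite -(many (enum (predC1 j))) ?mem_enum ?inE ?eqxx //.
- congr (a _); apply/ftransP=> x; rewrite !transE mem_enum inE.
  by case: eqP.
- by apply: contraTneq (ij : i \in predC1 j) => E; rewrite -mem_enum E.
Qed.

(** If [s] identifies [i] and [j], then [collapse [:: i] j * s = s], so the
    image of [s] does not change when a constant is multiplied on its left. *)
Lemma noninjective_singular a s x :
  ~ injective a -> parity s = None -> a s = a (const_map x).
Proof.
move=> aninj; case: parityP => // i j ij sij _.
have <- : collapse [:: i] j * s = s.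
  by apply/ftransP=> y; rewrite !transE inE; case: eqP => // ->.
rewrite endoM noninjective_collapse // -endoM const_mapM.
exact: noninjective_const.
Qed.

Lemma noninjective_parity a s t :
  ~ injective a -> parity s = parity t -> a s = a t.
Proof.
move=> aninj; case: (parityP s) => [p ->|i j ij sij].
  by case: parityP => // q -> [pq]; apply: noninjective_parity_perm.
move=> /esym t0; rewrite (noninjective_singular i aninj t0).
by apply: noninjective_singular => //; apply: parity_None ij sij.
Qed.

Lemma noninjective_idem a : idem a -> a <> 1 -> ~ injective a.
Proof.
move=> aa a1 ainj; apply: a1; apply: En_ext => s; apply: ainj.
by rewrite -En_mulE aa ftrans1E.
Qed.

End NoninjectiveEndomorphisms.

(** * The relations on the monoid of endomorphisms *)

(** The equation [h * a = a] says that [h s] and [s] are always identified by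
    [a], so it depends on [a] only through its kernel. *)
Lemma tildeR_of_ker n (a b : En n) :
  (forall s t, a s = a t <-> b s = b t) -> tildeR a b.
Proof.
move=> ab h _; split=> E; apply: En_ext => s; rewrite En_mulE;
  by apply/ab; rewrite -En_mulE E.
Qed.

Section TildeClasses.
Variable n : nat.
Hypothesis n5 : 4 < n.
Implicit Types (a b : En n) (s t : Tn n).

Let pt k (k5 : k < 5) : 'I_n := Ordinal (leq_trans k5 n5).
Let i0 := @pt 0 isT.
Let i1 := @pt 1 isT.
Let i2 := @pt 2 isT.
Let i3 := @pt 3 isT.

Lemma parity_const (x : 'I_n) : parity (const_map x) = None.
Proof.
by apply: (@parity_None _ i0 i1); rewrite // !transE.
Qed.

(** By definition [phi e e] takes the value [e * e] on even permutations; it is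
    an endomorphism only for idempotent [e], which is what makes it constant. *)
Lemma E1P a : a \in E1 n <-> forall s t, a s = a t.
Proof.
have phiee (e : Tn n) : e * e = e -> phi e e =1 fun=> e.
  by move=> ee s; rewrite phiE ee; case: parity => [[]|].
rewrite inE; split=> [/existsP[e /eqP ae]|ac].
  have aE s : a s = phi e e s by rewrite -ae.
  suff ee : e * e = e by move=> s t; rewrite !aE !phiee.
  have /(congr1 a) : const_map i0 * const_map i0 = const_map i0.
    exact: const_mapMr.
  by rewrite endoM !aE phiE parity_const.
apply/existsP; exists (a 1); apply/eqP/ftransP => s.
by rewrite phiee; [exact: ac | rewrite -endoM mulg1].
Qed.

Lemma notin_E1P a : a \notin E1 n <-> ~ forall s t, a s = a t.
Proof. by split=> [/negP aE /E1P|aE]; [|apply/negP => /E1P]. Qed.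

Lemma one_notin_E1 : 1 \notin E1 n.
Proof.
apply/notin_E1P => /(_ (const_map i0) (const_map i1)).
by rewrite !ftrans1E => /ftransP/(_ i0); rewrite !transE => /eqP.
Qed.

Lemma E1_mull a b : b \in E1 n -> a * b \in E1 n.
Proof. by move=> /E1P bc; apply/E1P=> s t; rewrite !En_mulE; apply: bc. Qed.

Lemma E1_mulr a b : a \in E1 n -> a * b \in E1 n.
Proof. by move=> /E1P ac; apply/E1P=> s t; rewrite !En_mulE (ac s t). Qed.

Lemma const_endo_subproof (x : 'I_n) :
  is_endo (phi (const_map x) (const_map x)).
Proof. by apply: phi_endo; rewrite !const_mapMr. Qed.

Definition const_endo x : En n := Endo (const_endo_subproof x).

Lemma const_endo_E1 x : const_endo x \in E1 n.
Proof. by rewrite inE; apply/existsP; exists (const_map x). Qed.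

(** Constant endomorphisms are right zeros, hence idempotents.  So they can be
    tested against each other in [tildeL] and [tildeR]. *)
Lemma E1_right_zero a b : b \in E1 n -> a * b = b.
Proof. by move=> /E1P bc; apply: En_ext => s; rewrite En_mulE; apply: bc. Qed.

Lemma tildeL_E1 a b : tildeL a b -> a \in E1 n -> b \in E1 n.
Proof.
move=> ab aE; have <- : b * a = b.
  by apply/(ab a (E1_right_zero a aE)); apply: E1_right_zero.
exact: E1_mull.
Qed.

Lemma tildeR_E1 a b : tildeR a b -> a \in E1 n -> b \in E1 n.
Proof.
move=> ab aE; pose c := const_endo i0.
have cE : c \in E1 n := const_endo_E1 _.
have <- : c * b = b.
  by apply/(ab c (E1_right_zero c cE)); apply: E1_right_zero.
exact: E1_mulr.
Qed.

Lemma tildeR_in_E1 a b : a \in E1 n -> b \in E1 n -> tildeR a b.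
Proof. by move=> aE bE h _; split=> _; apply: E1_right_zero. Qed.

(** The equation [a * h = a] says that [h] fixes the image of [a].  An
    idempotent [h] other than 1 is not injective, so it collapses all singular
    maps and cannot fix two of them. *)
Lemma tildeL_one_of_singular_image a s t :
  parity (a s) = None -> parity (a t) = None -> a s <> a t -> tildeL a 1.
Proof.
move=> s0 t0 st h hh; rewrite mul1g; split=> [ah|->]; last by rewrite mulg1.
have [//|/eqP/(noninjective_idem hh) hninj] := eqVneq h 1.
case: st; rewrite -ah !En_mulE.
by apply: noninjective_parity; rewrite ?s0 ?t0.
Qed.

Let odd_elt : Tn n := perm_map (tperm i0 i1).
Let e : Tn n := const_map i0.

Let parity_odd : parity odd_elt = Some true.
Proof. by rewrite parity_perm odd_tperm. Qed.

Let parity_one : parity (1 : Tn n) = Some false.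
Proof. by rewrite -perm_map1 parity_perm odd_perm1. Qed.

Let parity_e : parity e = None := parity_const _.

Lemma noninjectiveE a s : ~ injective a ->
  a s = if parity s is Some b then (if b then a odd_elt else a 1)
        else a e.
Proof.
by move=> aninj; case E: (parity s) => [[]|]; apply: noninjective_parity;
   rewrite ?E ?parity_one ?parity_odd ?parity_e.
Qed.

Lemma rank2_ker a s t :
    ~ injective a -> a \notin E1 n -> a odd_elt = a 1 ->
  a s = a t <-> isSome (parity s) = isSome (parity t).
Proof.
move=> aninj /notin_E1P aE ao.
have a1c : a 1 <> a e.
  move=> a1c; apply: aE => u v.
  rewrite (noninjectiveE u aninj) (noninjectiveE v aninj) ao a1c.
  by case: (parity u) => [[]|]; case: (parity v) => [[]|].
rewrite (noninjectiveE s aninj) (noninjectiveE t aninj) ao.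
by case: (parity s) => [[]|]; case: (parity t) => [[]|]; split=> // /esym.
Qed.

(** The three values of [a] multiply like the parities: the singular one is a
    zero for the other two, and the odd one squares to [a 1].  If the zero were
    equal to one of the other two, all three would be equal. *)
Lemma rank3_ker a s t :
    ~ injective a -> a odd_elt <> a 1 -> a s = a t <-> parity s = parity t.
Proof.
move=> aninj ao.
have ac : a e * a odd_elt = a e.
  by rewrite -endoM; apply: noninjective_parity; rewrite ?parityM ?parity_e.
have ac1 : a e <> a 1.
  by move=> E; apply: ao; rewrite -[odd_elt]mul1g endoM -E ac.
have aco : a e <> a odd_elt.
  move=> E; apply: ao; rewrite -E -ac {1}E -endoM -perm_mapM tperm2.
  by rewrite perm_map1.
rewrite (noninjectiveE s aninj) (noninjectiveE t aninj).
by case: (parity s) => [[]|]; case: (parity t) => [[]|]; split=> // /esym.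
Qed.

(* The maps that make up the witnesses: a singular idempotent c, a permutation w
   of order 2 commuting with it, and the constant e absorbing both.  The
   choices t = c and t = c * w below give ranks 2 and 3. *)
Let c : Tn n := collapse [:: i1] i0.
Let w : Tn n := perm_map (tperm i2 i3).

Let cc : c * c = c.
Proof.
by apply/ftransP=> x; rewrite !transE !inE; case E: (x == i1); rewrite ?E.
Qed.
Let ce : e * c = e.
Proof. by rewrite const_mapM transE. Qed.
Let parity_c : parity c = None.
Proof. by apply: (@parity_None _ i0 i1); rewrite // !transE. Qed.
Let c_neq_e : c <> e.
Proof. by move/ftransP/(_ i2); rewrite !transE => /eqP. Qed.
Let wc : w * c = c * w.
Proof.
apply/ftransP=> x; rewrite !transE !inE.
have i1w : tperm i2 i3 i1 = i1 by rewrite tpermD.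
rewrite -{1}i1w (inj_eq perm_inj); case: ifP => // _.
by rewrite tpermD.
Qed.

(** The image of [phi t e] contains the distinct singular maps [c] and [e], so
    [tildeL_one_of_singular_image] applies whatever [t] is. *)
Lemma phi_witness t :
    t * t = c -> c * t = t -> t * e = e -> e * t = e ->
  exists2 a : En n, [/\ ~ injective a, a \notin E1 n & tildeL a 1]
           & a odd_elt = t /\ a 1 = c.
Proof.
move=> tt ct te et.
have endo_t : is_endo (phi t e) by apply: phi_endo; rewrite ?tt ?const_mapMr.
pose a := Endo endo_t; have aE s : a s = phi t e s by [].
have a1 : a 1 = c by rewrite aE phiE parity_one tt.
have ax x : a (const_map x) = e by rewrite aE phiE parity_const.
exists a; last by rewrite aE phiE parity_odd.
split.
- move=> /(_ (const_map i0) (const_map i1)).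
  rewrite !ax => /(_ erefl)/ftransP/(_ i0).
  by rewrite !transE => /eqP.
- by apply/notin_E1P => /(_ 1 (const_map i0)); rewrite a1 ax.
- by apply: (@tildeL_one_of_singular_image a 1 (const_map i0));
    rewrite ?a1 ?ax ?parity_const.
Qed.

Lemma tildeD_of_ker_one a b :
  (forall s t, a s = a t <-> b s = b t) -> tildeL b 1 -> tildeD a 1.
Proof.
move=> ab b1 Q [_ _ Qtrans] QL QR.
by apply: Qtrans (QL _ _ b1); apply/QR/tildeR_of_ker.
Qed.

Lemma tildeD_one a : a \notin E1 n -> tildeD a 1.
Proof.
move=> aE; case: (boolP (injectiveb a)) => [/injectiveP ainj|/injectiveP aninj].
  apply: (@tildeD_of_ker_one a 1) => // s t; rewrite !ftrans1E.
  by split=> [/ainj|->].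
have [ao|/eqP ao] := eqVneq (a odd_elt) (a 1).
  have [||||b [bninj bE b1] [bo bid]] := @phi_witness c;
    rewrite ?const_mapMr //.
  apply: tildeD_of_ker_one b1 => s t.
  apply: iff_trans (rank2_ker s t aninj aE ao) (iff_sym _).
  by apply: rank2_ker => //; rewrite bo.
have [||||b [bninj bE b1] [bo bid]] := @phi_witness (c * w).
- rewrite mulgA -(mulgA c w) wc mulgA cc -mulgA.
  by rewrite -perm_mapM tperm2 perm_map1 mulg1.
- by rewrite mulgA cc.
- exact: const_mapMr.
- by rewrite mulgA ce const_mapM transE tpermD.
apply: tildeD_of_ker_one b1 => s t.
apply: iff_trans (rank3_ker s t aninj ao) (iff_sym _).
apply: rank3_ker => //; rewrite bo bid.
by move/ftransP/(_ i2); rewrite !transE /= tpermL => /eqP.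
Qed.

Lemma tildeD_E1 a b : tildeD a b <-> (a \in E1 n) = (b \in E1 n).
Proof.
split=> [Dab|abE].
  apply: (Dab (fun a b => (a \in E1 n) = (b \in E1 n))) => [|x y xy|x y xy].
  - by split=> // x y z -> ->.
  - by apply/idP/idP; apply: tildeL_E1 => // h hh; apply: iff_sym (xy h hh).
  - by apply/idP/idP; apply: tildeR_E1 => // h hh; apply: iff_sym (xy h hh).
move=> Q Qeq QL QR.
case: (boolP (a \in E1 n)) abE => aE /esym => [bE|/negbT bE].
  by apply/QR/tildeR_in_E1.
have [_ Qsym Qtrans] := Qeq.
exact: Qtrans (tildeD_one aE Qeq QL QR) (Qsym _ _ (tildeD_one bE Qeq QL QR)).
Qed.

Lemma tildeJ_E1 a b : tildeJ a b -> a \in E1 n -> b \in E1 n.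
Proof.
move=> ab aE; have /(_ (fun x => x \in E1 n)) : tildeJ_ideal a b by apply/ab.
apply=> //; [split | exact: tildeL_E1 | exact: tildeR_E1].
  by exists (const_endo i0); exact: const_endo_E1.
by move=> x y xE; split; [apply: E1_mull | apply: E1_mulr].
Qed.

End TildeClasses.

Lemma tildeD_sub_tildeJ (M : monoidType) (a b : M) : tildeD a b -> tildeJ a b.
Proof.
apply=> [|x y xy c|x y xy c].
- split=> [x c|x y xy c|x y z xy yz c]; first exact: iff_refl.
    exact: iff_sym (xy c).
  exact: iff_trans (xy c) (yz c).
- have yx : tildeL y x by move=> h hh; apply: iff_sym (xy h hh).
  by split=> Jc I Iid IL IR Ix; apply: (Jc I Iid IL IR); apply: IL Ix.
- have yx : tildeR y x by move=> h hh; apply: iff_sym (xy h hh).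
  by split=> Jc I Iid IL IR Ix; apply: (Jc I Iid IL IR); apply: IR Ix.
Qed.

Theorem proposition6p13 (n : nat) (hn : 5 <= n) :
  (forall C : {set En n},
     is_class_of (@tildeD (En n)) C <-> C = ~: E1 n \/ C = E1 n) /\
  (forall a b : En n, tildeJ a b <-> tildeD a b).
Proof.
have JE (a b : En n) : tildeJ a b -> (a \in E1 n) = (b \in E1 n).
  move=> ab; apply/idP/idP; apply: (tildeJ_E1 hn) => // c.
  exact: iff_sym (ab c).
split=> [C|a b]; last first.
  split=> [/JE ab|]; last exact: tildeD_sub_tildeJ.
  exact/(tildeD_E1 hn).
split=> [[a aC]|].
  have inC b : (b \in C) = ((a \in E1 n) == (b \in E1 n)).
    by apply/idP/eqP=> [/aC/(tildeD_E1 hn)|/(tildeD_E1 hn)/aC].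
  case: (boolP (a \in E1 n)) inC => _ inC; [right | left];
    by apply/setP=> b; rewrite inC ?in_setC; case: (b \in _).
case=> ->.
  exists 1 => b; apply: iff_trans (iff_sym (tildeD_E1 hn _ _)).
  by rewrite (negPf (one_notin_E1 hn)) in_setC; case: (b \in _).
exists (const_endo (Ordinal hn)) => b.
apply: iff_trans (iff_sym (tildeD_E1 hn _ _)).
by rewrite const_endo_E1; split.
Qed.
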